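(* Let the subsystem dimension $N\ge 1$, the spatial dimension $\gamma\in\mathbb{N}$, the range $\rho\ge 1$ and the maximal number $D_m$ of sensors connected to any given subsystem be fixed. Then for any real $c>0$ and any integer $N_c>0$ there exists a (large enough) number of subsystems $M$ such that the following holds: for every distributed sensing model among $M$ subsystems with a spatial structure of dimension $\gamma$, range $\rho$, and at most $D_m$ sensors connected to each subsystem, with measurement map $B$, the matrix $L=B^TB$ has at least $N_c$ eigenvalues (counted with multiplicity) smaller than $c$.
   Context: There are $M$ subsystems, each with an $N$-dimensional output; put $N_y=NM$ and let $q_k=\{kN+1,\dots,(k+1)N\}$ ($k=0,\dots,M-1$) be the index set of the outputs of subsystem $k$ in the stacked output $y\in\mathbb{R}^{N_y}$. There are $N_z\ge N_y$ sensors and a measurement map $B\in\mathbb{R}^{N_z\times N_y}$; each row of $B$ is one sensor. Relative measurements: $B$ gives (unit-gain) relative measurements if for each row $l\in\{1,\dots,N_z\}$ there exist two distinct subsystems $j,k$ such that $(B)_{l,m}=0$ for $m\notin q_j\cup q_k$, $\sum_{m\in q_j}|(B)_{l,m}|=\sum_{m\in q_j}(B)_{l,m}=1$, and $\sum_{m\in q_k}|(B)_{l,m}|=-\sum_{m\in q_k}(B)_{l,m}=1$. (Each row measures the difference between a convex combination of outputs of subsystem $j$ and a convex combination of outputs of subsystem $k$.) The sensor $l$ is then said to be connected to the subsystems $j$ and $k$, and to connect them. Spatial structure: a spatial structure of dimension $\gamma$ associates to each subsystem $k$ a position $p(k)\in\mathbb{R}^\gamma$ such that $\|p(k)-p(l)\|\ge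 1$ for all $l\ne k$ (Euclidean norm). Distributed sensing: given a spatial structure and $\rho\ge 1$, $B$ is a distributed sensing model of range $\rho$ (local relative measurements of range $\rho$) if it gives relative measurements and only connects subsystems $k,l$ for which $\|p(k)-p(l)\|\le\rho$. *)

(* Defs.v *)
From mathcomp Require Import all_boot all_order all_algebra.
From mathcomp Require Import reals.

Set Implicit Arguments.
Unset Strict Implicit.
Unset Printing Implicit Defensive.

Import Order.TTheory GRing.Theory Num.Theory.

Local Open Scope ring_scope.

(* Subsystems and output components are numbered from 0. *)
Definition outputs (N M : nat) (k : 'I_M) : {set 'I_(N * M)} :=
  [set m : 'I_(N * M) | (k * N <= m < k.+1 * N)%N].

(* [connects B l j k]: row [l] measures a convex combination of the outputs of
   [j] (positive sign) minus a convex combination of those of [k]; the pair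
   (j, k) is therefore ordered. *)
Definition connects (R : realType) (N M Nz : nat) (B : 'M[R]_(Nz, N * M))
    (l : 'I_Nz) (j k : 'I_M) : bool :=
  [&& j != k,
      [forall m, (m \notin outputs N j :|: outputs N k) ==> (B l m == 0)],
      \sum_(m in outputs N j) `|B l m| == 1,
      \sum_(m in outputs N j) B l m == 1,
      \sum_(m in outputs N k) `|B l m| == 1 &
      - (\sum_(m in outputs N k) B l m) == 1].

Definition relative_measurements (R : realType) (N M Nz : nat)
    (B : 'M[R]_(Nz, N * M)) : Prop :=
  forall l : 'I_Nz, exists j k : 'I_M, connects B l j k.

Definition connected_sensors (R : realType) (N M Nz : nat)
    (B : 'M[R]_(Nz, N * M)) (k : 'I_M) : {set 'I_Nz} :=
  [set l | [exists j, connects B l j k || connects B l k j]].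

(* The Euclidean norm; the library norm on row vectors is the sup norm. *)
Definition enorm (R : realType) (gamma : nat) (v : 'rV[R]_gamma) : R :=
  Num.sqrt (\sum_i v 0 i ^+ 2).

Definition spatial_structure (R : realType) (gamma M : nat)
    (p : 'I_M -> 'rV[R]_gamma) : Prop :=
  forall k l : 'I_M, l != k -> 1 <= enorm (p k - p l).

Definition distributed_sensing (R : realType) (gamma N M Nz : nat)
    (p : 'I_M -> 'rV[R]_gamma) (rho : R) (B : 'M[R]_(Nz, N * M)) : Prop :=
  relative_measurements B /\
  forall (l : 'I_Nz) (j k : 'I_M), connects B l j k -> enorm (p j - p k) <= rho.

(* [s] lists the eigenvalues of [A], each repeated according to its
   multiplicity; [s] is unique up to permutation. *)
Definition eigenvalue_list (R : realType) (n : nat) (A : 'M[R]_n) (s : seq R)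
    : Prop :=
  char_poly A = \prod_(x <- s) ('X - x%:P).

(* Main.v *)
Require Import Defs.
From mathcomp Require Import all_boot all_order all_algebra.
From mathcomp Require Import complex ring lra zify.
From mathcomp Require Import reals.

(** The eigenvalues of [L = B^T B] below [c] are at least as many as the
    dimension of any space on which [|B x|^2 < c |x|^2]
    ([count_eigenvalues_lt]).  Such a space is spanned by indicator vectors of
    sets of subsystems.  If [x] is constantly 1 on the outputs of the subsystems
    of [A] and 0 elsewhere, then a sensor reads 0 on [x], unless it connects [A]
    to its complement, in which case it reads 1 or -1; hence [|B x|^2] is the
    number of sensors cut by [A], while [|x|^2] is at least [#|A|].  So it is
    enough to find [Nc] disjoint sets, no two cut by a common sensor, each
    cutting fewer than [c * #|A|] sensors ([small_eigenvalues_of_cuts]).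

    These sets are balls.  Since the positions are 1-separated, a ball of radius
    [r] has at most polynomially many points in [r] ([card_ball]); so its size
    cannot grow by a factor [1 + eps] each time the radius increases by the
    sensing range: around each subsystem some radius below a uniform bound adds
    a shell of fewer than [eps] times the size of the ball ([slow_growth],
    [polynomial_lt_exponential]).  Every sensor cut by the ball is connected to
    a subsystem of this shell, so the cut has at most [Dm * eps * #|ball|]
    sensors ([card_cut_ball]).  Finally, since balls of the uniform radius have
    boundedly many points, a large number of subsystems leaves room for [Nc]
    centers that are far apart ([greedy_separated]), and then the balls and
    their cuts are disjoint ([disjoint_cut_balls]).

    Balls are taken for the sup norm: it is bounded by the Euclidean norm, and
    its triangle inequality holds coordinatewise. *)

Set Implicit Arguments.
Unset Strict Implicit.
Unset Printing Implicit Defensive.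

Import Order.TTheory GRing.Theory Num.Theory.

Local Open Scope ring_scope.

(** * Counting eigenvalues of real symmetric matrices *)

Section Spectral.

Local Open Scope sesquilinear_scope.
Local Open Scope complex_scope.

Lemma char_poly_conjugate (F : fieldType) (n : nat) (P A : 'M[F]_n) :
  P \in unitmx -> char_poly (invmx P *m A *m P) = char_poly A.
Proof.
move=> Pu; pose f := map_mx (@polyC F) : 'M_n -> 'M_n.
have Pf : f (invmx P) *m f P = 1%:M by rewrite -map_mxM mulVmx // map_mx1.
rewrite /char_poly.
have -> : char_poly_mx (invmx P *m A *m P) = f (invmx P) *m char_poly_mx A *m f P.
  rewrite /char_poly_mx mulmxBr mulmxBl mul_mx_scalar -scalemxAl Pf.
  by rewrite -!map_mxM scalemx1.
by rewrite !det_mulmx mulrAC -det_mulmx Pf det1 mul1r.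
Qed.

(** A real symmetric matrix is Hermitian over the complex closure [R[i]], so it
    has a unitary diagonalization there, with real eigenvalues.  A complex [P]
    is enough to count them. *)
Lemma symmetric_diagonalization (R : rcfType) (n : nat) (A : 'M[R]_n) :
  A^T = A ->
  exists (d : 'rV[R]_n) (P : 'M[R[i]]_n),
    P \is unitarymx /\
    map_mx (real_complex R) A =
      P^t* *m diag_mx (map_mx (real_complex R) d) *m P.
Proof.
move=> sA; set AC := map_mx _ A.
have hA : AC \is hermsymmx.
  apply: realsym_hermsym.
    by apply/is_hermitianmxP; rewrite expr0 scale1r map_mx_id // map_trmx sA.
  by apply/mxOverP => i j; rewrite mxE complex_real.
exists (map_mx (@complex.Re R) (spectral_diag AC)), (spectralmx AC).
split; first exact: spectral_unitarymx.
have -> : map_mx (real_complex R) (map_mx (@complex.Re R) (spectral_diag AC))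
    = spectral_diag AC.
  apply/rowP => j; rewrite !mxE.
  exact/RRe_real/(mxOverP (hermitian_spectral_diag_real hA)).
rewrite -invmx_unitary ?spectral_unitarymx //.
by apply/orthomx_spectralP/hermitian_normalmx.
Qed.

Lemma hermitian_diag_form (C : numClosedFieldType) (n : nat) (w e : 'rV[C]_n) :
  (w *m diag_mx e *m w^t*) 0 0 = \sum_j `|w 0 j| ^+ 2 * e 0 j.
Proof.
rewrite mxE; apply: eq_bigr => j _.
by rewrite mul_mx_diag !mxE normCK mulrAC.
Qed.

(** Half of the law of inertia.  In an orthonormal eigenbasis, if fewer than [k]
    eigenvalues were below [c], some nonzero combination [u] of the [k] rows of
    [F] would have no component along the corresponding eigenvectors; on it the
    form [c - A] is nonpositive, whereas it is positive on the row space of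
    [F]. *)
Lemma count_eigenvalues_lt (R : rcfType) (n k : nat) (A : 'M[R]_n) (c : R)
    (F : 'M[R]_(k, n)) (g : 'rV[R]_k) :
  A^T = A -> F *m (c%:M - A) *m F^T = diag_mx g -> (forall i, 0 < g 0 i) ->
  exists2 s : seq R, char_poly A = \prod_(x <- s) ('X - x%:P) &
    (k <= count (fun x : R => (x < c)%R) s)%N.
Proof.
move=> sA Fg g_gt0; have [d [P [Pu AE]]] := symmetric_diagonalization sA.
pose rc := real_complex R.
exists [seq d 0 i | i : 'I_n].
  apply: (map_inj_poly (@complexI R) (rmorph0 rc)).
  rewrite map_char_poly AE -invmx_unitary // char_poly_conjugate ?unitarymx_unit //.
  rewrite char_poly_trig ?diag_mx_is_trig //.
  rewrite big_map big_enum /= rmorph_prod; apply: eq_bigr => i _.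
  by rewrite /= rmorphB /= map_polyX map_polyC !mxE eqxx.
set S := [set i | d 0 i < c].
have -> : count (fun x : R => (x < c)%R) [seq d 0 i | i : 'I_n] = #|S|.
  by rewrite count_map -size_filter cardsE cardE [in RHS]/enum_mem enumT.
rewrite leqNgt; apply/negP => ltS.
(* The rows of [G] are the coordinates of the rows of [F] in the eigenbasis. *)
pose G := map_mx rc F *m P^t*.
have : ~~ row_free (colsub (enum_val : 'I_#|S| -> _) G).
  by rewrite /row_free neq_ltn (leq_ltn_trans (rank_leq_col _) ltS).
rewrite -kermx_eq0 => /rowV0Pn [u /sub_kermxP uG u0].
have PP : P^t* *m P = 1%:M by apply/mulmx1C/unitarymxP.
have FC : (map_mx rc F)^t* = map_mx rc F^T.
  by apply/matrixP => i j; rewrite !mxE conj_Creal // complex_real.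
pose e := map_mx rc (const_mx c - d).
have cAE : map_mx rc (c%:M - A) = P^t* *m diag_mx e *m P.
  rewrite map_mxB AE map_scalar_mx /e map_mxB map_const_mx linearB /=.
  by rewrite mulmxBr mulmxBl diag_const_mx mul_mx_scalar -scalemxAl PP scalemx1.
have Gg : G *m diag_mx e *m G^t* = diag_mx (map_mx rc g).
  rewrite -[RHS]map_diag_mx -Fg !map_mxM cAE.
  by rewrite /G trmx_mul map_mxM trmxCK FC !mulmxA.
pose w := u *m G.
have wS i : i \in S -> w 0 i = 0.
  move=> iS; move/rowP/(_ (enum_rank_in iS i)): uG.
  by rewrite mulmx_colsub mxE enum_rankK_in // => ->; rewrite mxE.
have /(congr1 (fun M : 'M_1 => M 0 0)) :
    w *m diag_mx e *m w^t* = u *m diag_mx (map_mx rc g) *m u^t*.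
  by rewrite -Gg /w trmx_mul map_mxM !mulmxA.
rewrite !hermitian_diag_form => E.
have : 0 < \sum_j `|u 0 j| ^+ 2 * map_mx rc g 0 j.
  have [j uj] : exists j, u 0 j != 0 by apply/rV0Pn.
  rewrite (bigD1 j) //= ltr_pwDl ?sumr_ge0 // => [|i _].
    by rewrite mulr_gt0 ?exprn_gt0 ?normr_gt0 // mxE (ltcR 0).
  by rewrite mulr_ge0 ?exprn_ge0 // mxE (lecR 0) ltW.
rewrite -E => /lt_geF/negP; apply; apply: sumr_le0 => i _.
have [iS|iS] := boolP (i \in S); first by rewrite wS // normr0 expr0n mul0r.
rewrite mulr_ge0_le0 ?exprn_ge0 // !mxE (lecR _ 0) subr_le0.
by move: iS; rewrite inE -leNgt.
Qed.

End Spectral.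

(** * Separation and growth *)

Lemma card_bigcup_le (I T : finType) (P : pred I) (A : I -> {set T}) :
  (#|\bigcup_(i | P i) A i| <= \sum_(i | P i) #|A i|)%N.
Proof.
elim/big_rec2: _ => [|i n U _ IH]; first by rewrite cards0.
by rewrite (leq_trans (leq_card_setU _ _)) // leq_add2l.
Qed.

(** As long as fewer than [n] points are chosen, their neighborhoods do not
    cover [T].  The values of [v] from [n] on are junk. *)
Lemma greedy_separated (T : finType) (nbr : T -> {set T}) (Q n : nat) :
  (forall x, #|nbr x| <= Q)%N -> (n * Q < #|T|)%N ->
  exists v : nat -> T, forall i j, (i < j < n)%N -> v j \notin nbr (v i).
Proof.
move=> nQ; elim: n => [|n IHn] ltT.
  have /card_gt0P [x _] : (0 < #|T|)%N by rewrite (leq_ltn_trans _ ltT).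
  by exists (fun=> x) => i j; rewrite ltn0 andbF.
have [|v vP] := IHn; first by rewrite (leq_ltn_trans _ ltT) // leq_mul2r leqnSn orbT.
pose U := \bigcup_(i < n) nbr (v i).
have [x xU] : exists x, x \in ~: U.
  apply/card_gt0P; rewrite cardsCs setCK subn_gt0.
  apply: leq_ltn_trans ltT; rewrite (leq_trans (card_bigcup_le _ _)) //.
  apply: leq_trans (_ : \sum_(i < n) Q <= _)%N; first exact: leq_sum.
  by rewrite sum_nat_const card_ord leq_mul2r leqnSn orbT.
exists (fun i => if (i < n)%N then v i else x) => i j /andP[ij].
rewrite ltnS leq_eqVlt => /predU1P[jn|jn]; last by rewrite jn (ltn_trans ij) // vP // ij.
subst j; rewrite ltnn ij; move: xU; rewrite inE; apply: contra => xi.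
by apply/bigcupP; exists (Ordinal ij).
Qed.

(** For [K = n * (g + 1)], the left side is at most [(A n)^g] for a constant
    [A], while by the Bernoulli inequality the right side is at least
    [(n e)^(g + 1)], which has one more factor [n]. *)
Lemma polynomial_lt_exponential (R : archiRealFieldType) (C g : nat) (e : R) :
  0 < e -> exists K : nat, ((C * K + 1) ^ g)%:R < (1 + e) ^+ K.
Proof.
move=> e0; pose A := (C * g.+1).+1.
have [n n_gt0 hn] : exists2 n : nat, (0 < n)%N & A%:R ^+ g < n%:R * e ^+ g.+1.
  exists (Num.bound (A%:R ^+ g / e ^+ g.+1)).+1 => //.
  rewrite -ltr_pdivrMr ?exprn_gt0 //.
  apply: lt_le_trans (archi_boundP _) _; last by rewrite ler_nat leqnSn.
  by rewrite divr_ge0 ?exprn_ge0 ?ltW.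
have bernoulli k : 1 + k%:R * e <= (1 + e) ^+ k.
  elim: k => [|k IHk]; first by rewrite mul0r addr0 expr0.
  rewrite exprS -natr1; apply: le_trans (_ : (1 + e) * (1 + k%:R * e) <= _).
    by have := mulr_ge0 (ler0n R k) (mulr_ge0 (ltW e0) (ltW e0)); lra.
  by rewrite ler_wpM2l // addr_ge0 // ltW.
exists (n * g.+1)%N.
apply: (@le_lt_trans _ _ ((A * n)%:R ^+ g)).
  by rewrite natrX lerXn2r ?nnegrE // ler_nat /A mulnA mulnAC mulSn addnC leq_add2r.
rewrite natrM exprMn exprM.
apply: (@lt_le_trans _ _ ((n%:R * e) ^+ g.+1)).
  by rewrite exprMn [n%:R ^+ g.+1]exprS mulrAC ltr_pM2r // exprn_gt0 // ltr0n.
have e1 : 0 <= 1 + e by rewrite addr_ge0 // ltW.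
rewrite lerXn2r ?nnegrE ?mulr_ge0 ?(exprn_ge0 _ e1) ?(ltW e0) //.
by rewrite (le_trans _ (bernoulli n)) // lerDr.
Qed.

(** Otherwise [b i >= a ^+ i] would propagate from [0] to [K]. *)
Lemma slow_growth (R : realDomainType) (a : R) (b : nat -> R) (K : nat) :
  0 <= a -> 1 <= b 0%N -> b K < a ^+ K ->
  exists2 i, (i < K)%N & b i.+1 < a * b i.
Proof.
move=> a0 b0; elim: K => [|K IHK]; first by rewrite expr0 ltNge b0.
have [ltK _|leK ltK] := ltP (b K) (a ^+ K).
  by have [i iK bi] := IHK ltK; exists i; rewrite // ltnS ltnW.
exists K => //; apply: lt_le_trans ltK _.
by rewrite exprS ler_wpM2l.
Qed.

(** * Balls in a spatial structure *)

(** The balls of the sup norm, with natural radius, seen as sets of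
    subsystems. *)
Definition ball (R : realType) (gamma M : nat) (p : 'I_M -> 'rV[R]_gamma)
    (r : nat) (v : 'I_M) : {set 'I_M} :=
  [set k | [forall i, `|p k 0 i - p v 0 i| <= r%:R]].

Section Ball.
Variables (R : realType) (gamma M : nat) (p : 'I_M -> 'rV[R]_gamma).

Lemma in_ballP (r : nat) (v k : 'I_M) :
  reflect (forall i, `|p k 0 i - p v 0 i| <= r%:R) (k \in ball p r v).
Proof. by rewrite inE; apply: forallP. Qed.

Lemma ball_center (r : nat) (v : 'I_M) : v \in ball p r v.
Proof. by apply/in_ballP => i; rewrite subrr normr0. Qed.

Lemma ball_sym (r : nat) (v k : 'I_M) : (k \in ball p r v) = (v \in ball p r k).
Proof. by rewrite !inE; apply: eq_forallb => i; rewrite distrC. Qed.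

Lemma ball_trans (r s : nat) (u v w : 'I_M) :
  v \in ball p r u -> w \in ball p s v -> w \in ball p (r + s) u.
Proof.
move=> /in_ballP vu /in_ballP wv; apply/in_ballP => i.
by rewrite (le_trans (ler_distD (p v 0 i) _ _)) // natrD addrC lerD.
Qed.

Lemma subset_ball (r s : nat) (v : 'I_M) : (r <= s)%N -> ball p r v \subset ball p s v.
Proof.
move=> rs; apply/subsetP => k /in_ballP kv; apply/in_ballP => i.
by rewrite (le_trans (kv i)) // ler_nat.
Qed.

Lemma enorm_ball (r : nat) (j k : 'I_M) :
  enorm (p j - p k) <= r%:R -> j \in ball p r k.
Proof.
move=> le_r; apply/in_ballP => i; apply: le_trans le_r.
rewrite /enorm -sqrtr_sqr ler_wsqrtr // (bigD1 i) //= !mxE lerDl.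
by rewrite sumr_ge0 // => ? _; rewrite sqr_ge0.
Qed.

(** Cut the cube of side [2 * r] into cells of side [1 / (gamma + 1)]: two
    points of one cell are at squared Euclidean distance at most
    [gamma / (gamma + 1) ^ 2 < 1], so 1-separated points lie in distinct
    cells. *)
Lemma card_ball (r : nat) (v : 'I_M) :
  spatial_structure p -> (#|ball p r v| <= (2 * gamma.+1 * r + 1) ^ gamma)%N.
Proof.
move=> sp; pose s := gamma.+1; pose y (k : 'I_M) i : R := s%:R * (p k 0 i - p v 0 i + r%:R).
have y_itv k i : k \in ball p r v -> 0 <= y k i <= (2 * s * r)%:R.
  move=> /in_ballP/(_ i); rewrite ler_norml => /andP[lo hi].
  rewrite /y mulr_ge0 //= ?ler_wpM2l; last by lra.
  rewrite (mulnC 2%N) -mulnA natrM ler_wpM2l // mulnC natrM; lra.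
(* [f k] is the cell of [k], coordinate by coordinate. *)
pose f (k : 'I_M) := [ffun i : 'I_gamma => inord (Num.truncn (y k i)) : 'I_(2 * s * r).+1].
have cardE : #|{ffun 'I_gamma -> 'I_(2 * s * r).+1}| = ((2 * gamma.+1 * r + 1) ^ gamma)%N.
  by rewrite card_ffun !card_ord addn1.
rewrite -cardE -(card_in_imset (f := f)) ?max_card // => k l kB lB fkl.
apply/eqP; apply: contraT; rewrite eq_sym => lk; have := sp k l lk.
have ykl i : (y k i - y l i) ^+ 2 <= 1.
  have [/andP[k0 kr] /andP[l0 lr]] := (y_itv k i kB, y_itv l i lB).
  have : Num.truncn (y k i) = Num.truncn (y l i).
    move/ffunP/(_ i)/(congr1 val): fkl; rewrite !ffunE /= !inordK //.
      by rewrite truncn_lt_nat // (le_lt_trans lr) // ltr_nat.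
    by rewrite truncn_lt_nat // (le_lt_trans kr) // ltr_nat.
  have := truncn_itv l0; have := truncn_itv k0 => /[swap] + /[swap] E.
  rewrite E -natr1 => /andP[? ?] /andP[? ?].
  rewrite -real_normK ?num_real // expr_le1 // ler_norml; apply/andP; split; lra.
rewrite /enorm => sep.
have : 1 <= \sum_i (p k - p l) 0 i ^+ 2.
  by rewrite -ler_sqrt ?sqrtr1 // sumr_ge0 // => i _; rewrite sqr_ge0.
rewrite leNgt => /negP; case; rewrite -(ltr_pM2l (_ : 0 < s%:R ^+ 2)) ?exprn_gt0 ?ltr0n //.
apply: (@le_lt_trans _ _ gamma%:R).
  have -> : gamma%:R = \sum_(i < gamma) (1 : R) by rewrite sumr_const card_ord.
  rewrite mulr_sumr ler_sum // => i _.
  apply: le_trans (ykl i); rewrite -exprMn le_eqVlt; apply/orP; left; apply/eqP.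
  by congr (_ ^+ 2); rewrite /y !mxE; ring.
by rewrite mulr1 -natrX ltr_nat /s; nia.
Qed.

End Ball.

(** * Indicator vectors and cut sensors *)

Lemma output_dim_gt0 (N M : nat) : 'I_(N * M) -> (0 < N)%N.
Proof. by case: N => // -[]. Qed.

Lemma subsystem_subproof (N M : nat) (m : 'I_(N * M)) : (m %/ N < M)%N.
Proof. by rewrite ltn_divLR ?(output_dim_gt0 m) // [leqRHS]mulnC. Qed.

Definition subsystem (N M : nat) (m : 'I_(N * M)) : 'I_M :=
  Ordinal (subsystem_subproof m).

Lemma in_outputs (N M : nat) (k : 'I_M) (m : 'I_(N * M)) :
  (m \in outputs N k) = (subsystem m == k).
Proof.
have N0 := output_dim_gt0 m.
rewrite inE -val_eqE /= -leq_divRL // -ltn_divLR // ltnS.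
by rewrite eqn_leq andbC.
Qed.

(** Entry [l] of the product of [B] with the indicator vector of the outputs of
    the subsystems in [A]. *)
Definition reading (R : realType) (N M Nz : nat) (B : 'M[R]_(Nz, N * M))
    (A : {set 'I_M}) (l : 'I_Nz) : R :=
  \sum_m (subsystem m \in A)%:R * B l m.

Lemma reading_connects (R : realType) (N M Nz : nat) (B : 'M[R]_(Nz, N * M))
    (A : {set 'I_M}) (l : 'I_Nz) (j k : 'I_M) :
  connects B l j k -> reading B A l = (j \in A)%:R - (k \in A)%:R.
Proof.
case/and5P=> jk /forallP B0 _ /eqP Bj /andP[_ /eqP Bk].
have sumq i : \sum_(m | subsystem m == i) (subsystem m \in A)%:R * B l m =
    (i \in A)%:R * \sum_(m in outputs N i) B l m.
  rewrite mulr_sumr; apply: eq_big => [m|m /eqP -> //].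
  by rewrite in_outputs.
rewrite /reading (partition_big (@subsystem N M) predT) //= (bigD1 j) //= sumq Bj.
rewrite (bigD1 k) 1?eq_sym //= sumq -[\sum_(m in _) _]opprK Bk big1 ?addr0 ?mulr1 ?mulrN1 //.
move=> i /andP[ij ik]; apply: big1 => m /eqP mi.
have /implyP/(_ _)/eqP -> := B0 m; first by rewrite mulr0.
by rewrite inE !in_outputs mi negb_or ij ik.
Qed.

(** Under relative measurements, the sensors connecting [A] to its complement
    (see [cut_connects]); defining them by a nonzero reading makes this
    independent of the choice of the pair that a sensor connects. *)
Definition cut (R : realType) (N M Nz : nat) (B : 'M[R]_(Nz, N * M))
    (A : {set 'I_M}) : {set 'I_Nz} := [set l | reading B A l != 0].

Lemma cut_connects (R : realType) (N M Nz : nat) (B : 'M[R]_(Nz, N * M))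
    (A : {set 'I_M}) (l : 'I_Nz) (j k : 'I_M) :
  connects B l j k -> (l \in cut B A) = ((j \in A) != (k \in A)).
Proof.
move=> jk; rewrite inE (reading_connects _ jk) subr_eq0.
by rewrite eqr_nat; case: (j \in A); case: (k \in A).
Qed.

Lemma reading_sqr (R : realType) (N M Nz : nat) (B : 'M[R]_(Nz, N * M))
    (A : {set 'I_M}) (l : 'I_Nz) :
  relative_measurements B -> reading B A l ^+ 2 = (l \in cut B A)%:R.
Proof.
move=> /(_ l) [j [k jk]]; rewrite (cut_connects _ jk) (reading_connects _ jk).
by case: (j \in A); case: (k \in A); rewrite ?subrr ?expr0n // ?subr0 ?sub0r ?sqrrN expr1n.
Qed.

Lemma card_outputs_ge (N M : nat) (A : {set 'I_M}) :
  (0 < N)%N -> (#|A| <= #|[set m : 'I_(N * M) | subsystem m \in A]|)%N.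
Proof.
move=> N0; set E := finset _.
apply: leq_trans (leq_imset_card (@subsystem N M) (mem E)).
apply/subset_leq_card/subsetP => k kA.
have kN : (k * N < N * M)%N by rewrite mulnC ltn_pmul2l.
have kE : subsystem (Ordinal kN) = k by apply: val_inj; rewrite /= mulnK.
by apply/imsetP; exists (Ordinal kN); rewrite ?kE // inE kE.
Qed.

(** The indicator vectors of disjoint sets are orthogonal, and so are their
    images by [B] when the cuts are disjoint; hence [c - B^T B] is diagonal on
    their span, with the entries [c * |x|^2 - |B x|^2], which are positive since
    [|x|^2] counts at least one output for each subsystem. *)
Lemma small_eigenvalues_of_cuts (R : realType) (N M Nz n : nat)
    (B : 'M[R]_(Nz, N * M)) (A : 'I_n -> {set 'I_M}) (c : R) :
  (0 < N)%N -> 0 < c -> relative_measurements B ->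
  (forall i j, i != j -> [disjoint A i & A j]) ->
  (forall i j, i != j -> [disjoint cut B (A i) & cut B (A j)]) ->
  (forall i, #|cut B (A i)|%:R < c * #|A i|%:R) ->
  exists2 s : seq R, eigenvalue_list (B^T *m B) s &
    (n <= count (fun x : R => (x < c)%R) s)%N.
Proof.
move=> N0 c0 rel dA dcut small.
pose F : 'M[R]_(n, N * M) := \matrix_(i, m) (subsystem m \in A i)%:R.
pose g : 'rV[R]_n := \row_i (c * #|[set m : 'I_(N * M) | subsystem m \in A i]|%:R
                             - #|cut B (A i)|%:R).
apply: (@count_eigenvalues_lt _ _ _ _ _ F g).
- by rewrite trmx_mul trmxK.
- have -> : F *m (c%:M - B^T *m B) *m F^T =
      c *: (F *m F^T) - (F *m B^T) *m (F *m B^T)^T.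
    by rewrite mulmxBr mulmxBl mul_mx_scalar -scalemxAl trmx_mul trmxK !mulmxA.
  have FB i l : (F *m B^T) i l = reading B (A i) l.
    by rewrite mxE; apply: eq_bigr => m _; rewrite !mxE.
  apply/matrixP => i j; rewrite !mxE; have [<-|ij] := eqVneq i j.
    rewrite mulr1n; congr (_ * _ - _).
      rewrite -sum1_card natr_sum [RHS]big_mkcond /=; apply: eq_bigr => m _.
      by rewrite !mxE inE; case: (_ \in _); rewrite ?mulr1 ?mulr0.
    rewrite -sum1_card natr_sum [RHS]big_mkcond /=; apply: eq_bigr => l _.
    by rewrite [_^T _ _]mxE !FB -expr2 reading_sqr //; case: (_ \in _).
  rewrite mulr0n [X in c * X]big1 => [|m _]; last first.
    rewrite !mxE; case: (boolP (subsystem m \in A i)) => [mi|]; last by rewrite mul0r.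
    by rewrite (disjointFr (dA _ _ ij) mi) mulr0.
  rewrite big1 ?mulr0 ?subr0 // => l _; rewrite [_^T _ _]mxE !FB.
  apply/eqP; rewrite mulf_eq0; apply: contraT; rewrite negb_or => /andP[li lj].
  have : l \in cut B (A i) by rewrite inE.
  by move=> /(disjointFr (dcut _ _ ij)); rewrite inE lj.
- move=> i; rewrite mxE subr_gt0 (lt_le_trans (small i)) // ler_pM2l // ler_nat.
  exact: card_outputs_ge.
Qed.

(** * Sensors cut by balls *)

Section Cut.
Variables (R : realType) (gamma N M Nz d Dm : nat) (rho : R).
Variables (p : 'I_M -> 'rV[R]_gamma) (B : 'M[R]_(Nz, N * M)).
Hypotheses (ds : distributed_sensing p rho B) (rhod : rho <= d%:R).

Lemma cut_ball_ends (r : nat) (v j k : 'I_M) (l : 'I_Nz) :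
  connects B l j k -> l \in cut B (ball p r v) ->
  j \in ball p (r + d) v /\ k \in ball p (r + d) v.
Proof.
move=> jk; rewrite (cut_connects _ jk).
have jkd : j \in ball p d k by rewrite enorm_ball // (le_trans (ds.2 _ _ _ jk)).
have widen i : i \in ball p r v -> i \in ball p (r + d) v.
  by apply: subsetP i; rewrite subset_ball ?leq_addr.
have [jv|jv] := boolP (j \in _); have [kv|kv] := boolP (k \in _) => // _.
  by split; [exact: widen | rewrite (ball_trans jv) // ball_sym].
by split; [exact: ball_trans jkd | exact: widen].
Qed.

(** Each cut sensor has an end outside the ball, and within range [d] of it:
    charge it to this end, which lies in the shell of width [d]. *)
Lemma card_cut_ball (r : nat) (v : 'I_M) :
  (forall k : 'I_M, (#|connected_sensors B k| <= Dm)%N) ->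
  (#|cut B (ball p r v)| <= (#|ball p (r + d) v| - #|ball p r v|) * Dm)%N.
Proof.
move=> deg; rewrite -cardsDS ?subset_ball ?leq_addr //.
rewrite -sum_nat_const; apply: leq_trans (leq_sum _ (fun k _ => deg k)).
apply: leq_trans (card_bigcup_le _ _); apply/subset_leq_card/subsetP => l.
have [j [k jk]] := ds.1 l; move=> lcut; have [jd kd] := cut_ball_ends jk lcut.
move: lcut; rewrite (cut_connects _ jk); case: (boolP (j \in _)) => jr kr.
  apply/bigcupP; exists k; first by rewrite in_setD kd andbT; case: (k \in _) kr.
  by rewrite inE; apply/existsP; exists j; rewrite jk.
apply/bigcupP; exists j; first by rewrite in_setD jr.
by rewrite inE; apply/existsP; exists k; rewrite jk orbT.
Qed.

(** A sensor cut by both balls has both ends within [d] of the first ball and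
    one end in the second. *)
Lemma disjoint_cut_balls (r s : nat) (u v : 'I_M) :
  v \notin ball p (r + d + s) u ->
  [disjoint ball p r u & ball p s v] /\
  [disjoint cut B (ball p r u) & cut B (ball p s v)].
Proof.
move=> vu.
have far j : j \in ball p (r + d) u -> j \in ball p s v -> False.
  move=> ju jv; case/negP: vu; apply: ball_trans ju _; by rewrite ball_sym.
split; apply/pred0P => l; apply/negP => /andP[lu lv].
  by apply: (far l) lv => //; apply: subsetP lu; rewrite subset_ball ?leq_addr.
have [j [k jk]] := ds.1 l; have [ju ku] := cut_ball_ends jk lu.
move: lv; rewrite /= (cut_connects _ jk).
have [/(far _ ju) //|_] := boolP (j \in _).
by have [/(far _ ku) //|_] := boolP (k \in _).
Qed.

End Cut.

Theorem proposition1 (R : realType) (N gamma : nat) (rho : R) (Dm : nat)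
    (hN : (1 <= N)%N) (hrho : 1 <= rho) :
  forall (c : R) (Nc : nat), 0 < c -> (0 < Nc)%N ->
  exists M0 : nat, forall M : nat, (M0 <= M)%N ->
  forall (Nz : nat) (p : 'I_M -> 'rV[R]_gamma) (B : 'M[R]_(Nz, N * M)),
    (N * M <= Nz)%N ->
    spatial_structure p ->
    distributed_sensing p rho B ->
    (forall k : 'I_M, (#|connected_sensors B k| <= Dm)%N) ->
    exists2 s : seq R, eigenvalue_list (B^T *m B) s &
      (Nc <= count (fun x : R => (x < c)%R) s)%N.
Proof.
move=> c Nc c0 _; pose d := Num.bound rho.
have rhod : rho <= d%:R by rewrite ltW // archi_boundP // (le_trans ler01).
(* [Dm.+1] rather than [Dm] keeps [Dm * eps < c] strict, also if [Dm = 0]. *)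
pose eps := c / Dm.+1%:R; have eps0 : 0 < eps by rewrite divr_gt0 ?ltr0n.
have [K KP] := polynomial_lt_exponential (2 * gamma.+1 * d) gamma eps0.
(* Two radii of at most [K * d], and a gap [d] that a sensor cannot bridge. *)
pose T := (2 * K * d + d)%N.
pose Q := ((2 * gamma.+1 * T + 1) ^ gamma)%N.
exists (Nc * Q).+1 => M MP Nz p B _ sp ds deg.
have radius (v : 'I_M) : exists i, (i <= K)%N /\
    #|ball p (i * d + d) v|%:R < (1 + eps) * #|ball p (i * d) v|%:R.
  have [|||i iK iP] := @slow_growth _ (1 + eps) (fun i => #|ball p (i * d) v|%:R) K.
  - by rewrite addr_ge0 // ltW.
  - by rewrite ler1n; apply/card_gt0P; exists v; apply: ball_center.
  - apply: le_lt_trans KP; rewrite ler_nat -mulnA [(d * K)%N]mulnC.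
    exact: card_ball.
  - by exists i; rewrite ltnW // addnC.
have [r rP] := fin_all_exists radius.
have [|w wP] := @greedy_separated _ (ball p T) Q Nc (fun v => card_ball T v sp).
  by rewrite card_ord.
have far (i j : 'I_Nc) : i != j ->
    w j \notin ball p (r (w i) * d + d + r (w j) * d) (w i).
  move=> ij; have : w j \notin ball p T (w i).
    have [ltij|ltji|/val_inj eij] := ltngtP i j; first by rewrite wP // ltij /=.
      by rewrite ball_sym wP // ltji /=.
    by rewrite eij eqxx in ij.
  apply: contra; apply: subsetP; apply: subset_ball.
  by have [[ri _] [rj _]] := (rP (w i), rP (w j)); rewrite /T; nia.
apply: (@small_eigenvalues_of_cuts _ _ _ _ _ _
          (fun i : 'I_Nc => ball p (r (w i) * d) (w i))) => //.
- exact: ds.1.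
- by move=> i j /far /(disjoint_cut_balls ds rhod) [].
- by move=> i j /far /(disjoint_cut_balls ds rhod) [].
move=> i; have [_ grow] := rP (w i).
pose b := ball p (r (w i) * d) (w i).
have b_gt0 : 0 < #|b|%:R :> R.
  by rewrite ltr0n; apply/card_gt0P; exists (w i); apply: ball_center.
have cutle := card_cut_ball ds rhod (r (w i) * d) (w i) deg.
apply: (@le_lt_trans _ _ ((eps * #|b|%:R) * Dm%:R)).
  apply: le_trans (_ : (#|ball p (r (w i) * d + d) (w i)| - #|b|)%N%:R * Dm%:R <= _).
    by rewrite -natrM ler_nat.
  rewrite ler_wpM2r // natrB ?subset_leq_card ?subset_ball ?leq_addr //.
  by rewrite lerBlDl -[X in X + _]mul1r -mulrDl ltW.
rewrite mulrAC ltr_pM2r // /eps mulrAC ltr_pdivrMr ?ltr0n //.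
by rewrite ltr_pM2l // ltr_nat.
Qed.
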